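(* Fix a good basis of $2^\omega$. (a) There exists a continuous injection $I:2^\omega\rightarrow\mathcal{B}_1(2^\omega,2)$ such that $I[2^\omega]$ is not uniformly recoverable, and in fact such that the evaluation map $\phi:2^\omega\times I[2^\omega]\to 2$, $\phi(x,f)=f(x)$, is not Baire class one. (b) There exists $A\subseteq\mathcal{B}_1(2^\omega,2)$, homeomorphic to $\omega^\omega$, which is not uniformly recoverable and such that the evaluation map $\phi:2^\omega\times A\to 2$, $\phi(x,f)=f(x)$, is Baire class one.
   Context: $2=\{0,1\}$ is discrete. For topological spaces $X,Y$, a function $f:X\to Y$ is Baire class one if $f^{-1}(U)$ is $F_\sigma$ for every open $U\subseteq Y$; $\mathcal{B}_1(X,Y)$ is the set of such functions, equipped with the topology of pointwise convergence; its subsets carry the subspace topology. A basis $(W_m)_{m\in\omega}$ for the topology of $X$ is a good basis if for each open $U\subseteq X$ and each $x\in U$ there is $m_0$ such that for all $m\geq m_0$: if $x\in W_m$ then $W_m\subseteq U$. Fix a good basis $(W_m)$ of $X$. For a dense sequence $D=(x_p)_{p\in\omega}$ in $X$ and $x\in X$, define: $s_0[x,D]:=x_0$; $s_{n+1}[x,D]:=s_n[x,D]$ if $x=s_n[x,D]$; otherwise $s_{n+1}[x,D]:=x_p$, where $p$ is least such that there exists $m$ with $\{x,x_p\}\subseteq W_m\subseteq X\setminus\{s_0[x,D],\ldots,s_n[x,D]\}$. $f:X\to Y$ is recoverable with respect to $D$ if $f(s_n[x,D])\to f(x)$ for each $x\in X$. $A\subseteq\mathcal{B}_1(X,Y)$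 is uniformly recoverable if there is a dense sequence $D$ of $X$ such that every $f\in A$ is recoverable with respect to $D$. *)

(* Defs.v *)
From HB Require Import structures.
From mathcomp Require Import all_boot all_order all_algebra.
From mathcomp Require Import boolp classical_sets functions cardinality.
From mathcomp Require Import reals topology cantor borel_hierarchy.

Set Implicit Arguments.
Unset Strict Implicit.
Unset Printing Implicit Defensive.

Local Open Scope classical_set_scope.

Definition baire_class_one (X Y : topologicalType) (f : X -> Y) : Prop :=
  forall U : set Y, open U -> Fsigma (f @^-1` U).

(* Used as a type, [baire1 X Y] is coerced to [set_type], whose topology is
   the one induced by the product topology [{ptws X -> Y}]; the same applies
   to every [A : set (baire1 X Y)]. (The library's [subspace A] would instead
   be a topology on the whole ambient type.) *)
Definition baire1 (X Y : topologicalType) : set {ptws X -> Y} :=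
  [set f : {ptws X -> Y} | baire_class_one (f : X -> Y)].
Arguments baire1 : clear implicits.

Definition fun_of_baire1 (X Y : topologicalType) (f : baire1 X Y) : X -> Y :=
  set_val f.

Definition evaluation (X Y : topologicalType) (A : set (baire1 X Y))
    (p : X * A) : Y :=
  fun_of_baire1 (set_val p.2) p.1.

Definition good_basis (X : topologicalType) (W : nat -> set X) : Prop :=
  basis (range W) /\
  forall (U : set X) (x : X), open U -> U x ->
    exists m0 : nat, forall m : nat, (m0 <= m)%N -> W m x -> W m `<=` U.

Definition candidate (X : topologicalType) (W : nat -> set X) (D : nat -> X)
    (x : X) (S : set X) (p : nat) : Prop :=
  exists m : nat, [set x; D p] `<=` W m /\ W m `<=` ~` S.

(* The least candidate; the default value 0 is never used when W is a basis,
   D is dense and S is a closed set avoiding x, see [candidate_exists]. *)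
Definition least_candidate (X : topologicalType) (W : nat -> set X)
    (D : nat -> X) (x : X) (S : set X) : nat :=
  xget 0%N [set p | candidate W D x S p /\
                    forall q, candidate W D x S q -> (p <= q)%N].

(* The pair (s_n, {s_0, ..., s_n}). *)
Fixpoint recovery_state (X : topologicalType) (W : nat -> set X)
    (D : nat -> X) (x : X) (n : nat) : X * set X :=
  match n with
  | 0 => (D 0%N, [set D 0%N])
  | k.+1 =>
      let: (s, V) := recovery_state W D x k in
      let s' := if x == s then s else D (least_candidate W D x V) in
      (s', V `|` [set s'])
  end.

Definition recovery_seq (X : topologicalType) (W : nat -> set X)
    (D : nat -> X) (x : X) (n : nat) : X :=
  (recovery_state W D x n).1.

Definition recoverable (X Y : topologicalType) (W : nat -> set X)
    (D : nat -> X) (f : X -> Y) : Prop :=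
  forall x : X, (fun n : nat => f (recovery_seq W D x n)) @ \oo --> f x.

Definition uniformly_recoverable (X Y : topologicalType) (W : nat -> set X)
    (A : set (baire1 X Y)) : Prop :=
  exists D : nat -> X, dense (range D) /\
    forall f : baire1 X Y, A f -> recoverable W D (fun_of_baire1 f).

Definition homeomorphic (X Y : topologicalType) : Prop :=
  exists (f : X -> Y) (g : Y -> X),
    [/\ cancel f g, cancel g f, continuous f & continuous g].

Definition baire_space : topologicalType := {ptws nat -> nat}.

Lemma recovery_state2 (X : topologicalType) (W : nat -> set X) (D : nat -> X)
    (x : X) (n : nat) :
  (recovery_state W D x n).2 =
  [set recovery_seq W D x i | i in [set i | (i <= n)%N]].
Proof.
elim: n => [|n IHn].
  apply/seteqP; split => y /=; first by move=> ->; exists 0%N.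
  by move=> [[|i]//= _ <-].
have -> : (recovery_state W D x n.+1).2 =
    (recovery_state W D x n).2 `|` [set recovery_seq W D x n.+1].
  by rewrite /recovery_seq /=; case: (recovery_state W D x n).
rewrite IHn; apply/seteqP; split => y.
  move=> [[i /= i_le <-]|->]; last by exists n.+1 => /=.
  by exists i => //=; exact: leqW.
move=> [i /=]; rewrite leq_eqVlt => /orP[/eqP -> <-|i_lt <-]; first by right.
by left; exists i.
Qed.

Lemma recovery_seqS (X : topologicalType) (W : nat -> set X) (D : nat -> X)
    (x : X) (n : nat) :
  recovery_seq W D x n.+1 =
  if x == recovery_seq W D x n then recovery_seq W D x n
  else D (least_candidate W D x
            [set recovery_seq W D x i | i in [set i | (i <= n)%N]]).
Proof.
rewrite -recovery_state2 /recovery_seq /=.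
by case: (recovery_state W D x n).
Qed.

Lemma candidate_exists (X : topologicalType) (W : nat -> set X) (D : nat -> X)
    (x : X) (S : set X) :
  basis (range W) -> dense (range D) -> closed S -> ~ S x ->
  let p := least_candidate W D x S in
  candidate W D x S p /\ forall q, candidate W D x S q -> (p <= q)%N.
Proof.
move=> [Wo Wb] dD cS Sx /=; rewrite /least_candidate; set P := (X in xget _ X).
suff [q Pq] : exists q, P q by exact: (xgetI _ Pq).
have nS : nbhs x (~` S).
  by apply: open_nbhs_nbhs; split => //; exact: closed_openC.
have [_ [[m _ <-] Wmx] WmS] := Wb x _ nS.
have [y [Wmy [p _ Dpy]]] : W m `&` range D !=set0.
  by apply: dD; [exists x | apply: Wo; exists m].
have ex_cand : exists q, `[< candidate W D x S q >].
  exists p; apply/asboolP; exists m; split => // z [->//|->].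
  by rewrite Dpy.
have [q /asboolP qc qmin] := ex_minnP ex_cand.
by exists q; split => // r rc; apply: qmin; apply/asboolP.
Qed.

(* Main.v *)
(* Points of the Cantor space are subsets of nat.  Let [f_a] be the indicator of
   the finite initial segments [trunc a n] of [a]; [a |-> f_a] is continuous and
   injective.  The diagonal [a |-> f_a(a)] is the indicator of the finite sets,
   which is not Baire class one, and this settles the evaluation map in (a).  For
   (b), keep only the [f_a] with [a] infinite and [0 \in a]; such [a] are
   enumerated increasingly and the gaps give a copy of [omega^omega].  For these,
   [f_a(x) = 1] iff [(x, a)] lies in a closed relation and [x <> a].
   If a dense sequence [D] recovered all these [f_a], then [D] would contain every
   finite set containing [0]: otherwise [s_n[x, D]] would be an injective sequence
   that is eventually among the initial segments of any [a] extending [x], hence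
   among the finitely many initial segments of [x].  But whenever [x] is a term
   of [D], all [y] close to [x] have [x] among the [s_n[y, D]].  So one can build
   an infinite [a] having infinitely many of its own initial segments among the
   [s_n[a, D]], although [f_a(a) = 0]. *)

Require Import Defs.
From HB Require Import structures.
From mathcomp Require Import all_boot all_order all_algebra.
From mathcomp Require Import boolp classical_sets functions cardinality.
From mathcomp Require Import reals topology cantor borel_hierarchy.

Local Open Scope classical_set_scope.

(** * Continuity and neighbourhoods in products of discrete spaces *)

Lemma ptws_continuous (X : topologicalType) (I : Type) (K : topologicalType)
    (f : X -> {ptws I -> K}) :
  (forall i, continuous (fun x => f x i)) -> continuous f.
Proof.
move=> cf x; apply/cvg_sup => i.
exact: (@continuous_comp_initial _ X K (fun g : {ptws I -> K} => g i) f (cf i) x).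
Qed.

Lemma near_continuous (X : topologicalType) (K : discreteTopologicalType)
    (f : X -> K) : (forall x, \forall y \near x, f y = f x) -> continuous f.
Proof. by move=> fx x; apply/discrete_cvg; exact: fx. Qed.

Lemma continuous_near (X : topologicalType) (K : discreteTopologicalType)
    (f : X -> K) : continuous f -> forall x, \forall y \near x, f y = f x.
Proof. by move=> cf x; exact: (cf x _ (discrete_set1 (f x))). Qed.

Lemma nbhs_agree (K : discreteTopologicalType) (x : {ptws nat -> K}) (n : nat) :
  \forall y \near x, forall k, (k < n)%N -> y k = x k.
Proof.
have Fx : Filter (nbhs x) := @nbhs_filter {ptws nat -> K} x.
elim: n => [|n IHn]; first exact: (@filterE _ (nbhs x)).
have xn : \forall y \near x, y n = x n.
  exact: (@proj_continuous nat (fun=> K) n x _ (discrete_set1 (x n))).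
apply: filterS2 IHn xn => y IHy yn k.
by rewrite ltnS leq_eqVlt => /predU1P[->//|]; exact: IHy.
Qed.

(** Otherwise points outside [V] agreeing with [x] on ever longer prefixes would converge to [x]. *)
Lemma agree_nbhs (x : cantor_space) (V : set cantor_space) : nbhs x V ->
  exists n, forall y : cantor_space, (forall k, (k < n)%N -> y k = x k) -> V y.
Proof.
move=> xV; apply: contrapT => /forallNP nV.
have /choice[y yP] : forall n, exists y : cantor_space,
    (forall k, (k < n)%N -> y k = x k) /\ ~ V y.
  by move=> n; have /existsNP[y /not_implyP] := nV n; exists y.
have : y @ \oo --> x.
  apply/cvg_sup => i U [_ [[B _ <-] Bx] BU].
  exists i.+1 => // n /= ltin; apply: BU.
  by rewrite /preimage/= (proj1 (yP n)).
by move=> /(_ V xV) [n _ /(_ n (leqnn n))]; exact: (proj2 (yP n)).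
Qed.

Lemma no_injection_below (T : Type) (u c : nat -> T) (N : nat) :
  injective u -> ~ forall k, exists2 m, (m < N)%N & u k = c m.
Proof.
move=> uI uc; have /choice[g gP] : forall k, exists m : 'I_N, u k = c m.
  by move=> k; have [m mN ukm] := uc k; exists (Ordinal mN).
pose h (k : 'I_N.+1) := g k.
have hI : injective h.
  by move=> i j hij; apply/val_inj/uI; rewrite !gP -/(h i) -/(h j) hij.
by have := leq_card h hI; rewrite !card_ord ltnn.
Qed.

(** * Finite initial segments and the functions f_a *)

Definition trunc (a : cantor_space) (n : nat) : cantor_space :=
  fun i => (i < n)%N && a i.

Lemma trunc_trunc (a : cantor_space) (m n : nat) :
  trunc (trunc a n) m = trunc a (minn m n).
Proof. by apply/funext => i; rewrite /trunc leq_min andbA. Qed.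

Lemma eq_trunc (a b : cantor_space) (n : nat) :
  (forall k, (k < n)%N -> a k = b k) -> trunc a n = trunc b n.
Proof.
by move=> ab; apply/funext => i; rewrite /trunc; case: ltnP => // /ab.
Qed.

Definition truncations (a : cantor_space) : {ptws cantor_space -> bool} :=
  fun x => `[< exists n, x = trunc a n >].

Lemma truncations_inj : injective truncations.
Proof.
suff sub a b i : truncations a = truncations b -> a i -> b i.
  by move=> a b ab; apply/funext => i; apply/idP/idP; exact: sub.
move=> ab ai; have : truncations b (trunc a i.+1).
  by rewrite -ab; apply/asboolP; exists i.+1.
move=> /asboolP[n /(congr1 (@^~ i))]; rewrite /trunc ltnSn ai.
by move=> /esym/andP[].
Qed.

(** Fix [x]. An infinite [x] is a truncation of no [a]. A finite [x], bounded by [m], is a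
    truncation of [a], if at all, already at some length at most [m], so the value depends only on
    [a] below [m]. *)
Lemma truncations_continuous : continuous truncations.
Proof.
apply: ptws_continuous => x; apply: near_continuous => a.
have [[m xE]|x_inf] := pselect (exists m, x = trunc x m); last first.
  apply: (@filterE _ (nbhs a)) => b; rewrite /truncations; congr (asbool _).
  by apply/propext; split=> -[n xE]; case: x_inf; exists n; rewrite xE trunc_trunc minnn.
apply: (@filterS _ (nbhs a)) (@nbhs_agree bool a m) => b ba.
rewrite /truncations; congr (asbool _); apply/propext.
have x_trunc c : (exists n, x = trunc c n) ->
    exists2 n, (n <= m)%N & x = trunc c n.
  move=> [n xn]; exists (minn m n); first exact: geq_minl.
  by rewrite -trunc_trunc -xn.
by split=> /x_trunc[n nm ->]; exists n; apply: eq_trunc => k kn;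
  rewrite ba// (leq_trans kn nm).
Qed.

(** A clopen condition on [(x, a)]; the conjunction over all [i] is the closed relation of being an
    initial segment, [x = a] included. *)
Definition agree_upto (x a : cantor_space) (i : nat) : bool :=
  x i ==> [forall j : 'I_i.+1, x j == a j].

Lemma agree_uptoP (x a : cantor_space) :
  (forall i, agree_upto x a i) <-> x = a \/ exists n, x = trunc a n.
Proof.
split=> [xa|[->|[n ->] i]]; last 2 first.
- by move=> i; apply/implyP => _; apply/forallP => j.
- apply/implyP => /andP[ltin _]; apply/forallP => j.
  by rewrite /trunc (leq_trans (ltn_ord j)).
have [->|/eqP xDa] := eqVneq x a; [by left|right].
have ex_i : exists i, x i != a i.
  apply: contrapT => /forallNP xEa; apply: xDa; apply/funext => i.
  by apply/eqP/negPn/negP/xEa.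
(* Past the first disagreement [n], [x] has no element, since [agree_upto] at such an element would
   force agreement at [n]. *)
have [n xan n_min] := ex_minnP ex_i.
exists n; apply/funext => j; rewrite /trunc; case: ltnP => [ltjn|lenj] /=.
  by apply/eqP/negPn/negP => /n_min; rewrite leqNgt ltjn.
apply: contraNF xan => xj; have /implyP/(_ xj)/forallP := xa j.
by move=> /(_ (Ordinal (lenj : n < j.+1)%N)).
Qed.

Lemma truncationsP (x a : cantor_space) :
  (forall n, a <> trunc a n) ->
  truncations a x = true <-> (forall i, agree_upto x a i) /\ x <> a.
Proof.
move=> a_inf; split=> [/asboolP xa|[/agree_uptoP[//|xa] _]]; last exact/asboolP.
split; first by apply/agree_uptoP; right.
by move=> xE; have [n xn] := xa; apply: (a_inf n); rewrite -xn xE.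
Qed.

(** A finite [a] is one of its own truncations and must not be excluded. Excluding the full set
    instead is harmless, as it is no truncation, and keeps the shape of [truncationsP]. *)
Lemma truncationsP_finite (x a : cantor_space) (n : nat) : a = trunc a n ->
  truncations a x = true <-> (forall i, agree_upto x a i) /\ x <> (fun=> true).
Proof.
move=> aE; split=> [/asboolP [m xm]|[/agree_uptoP[->|xa] _]]; last 2 first.
- by apply/asboolP; exists n.
- exact/asboolP.
split; first by apply/agree_uptoP; right; exists m.
by move=> /(congr1 (@^~ m)); rewrite xm /trunc ltnn.
Qed.

(** * Infinite sets containing 0, coded by their gaps *)

(* [beta] lists the gaps of the increasing enumeration [elt beta] of
   [elts beta], starting at 0. *)
Fixpoint elt (beta : nat -> nat) (n : nat) : nat :=
  if n is m.+1 then (elt beta m + beta m).+1 else 0%N.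

Lemma eq_elt (beta gamma : nat -> nat) (n : nat) :
  (forall k, (k < n)%N -> beta k = gamma k) -> elt beta n = elt gamma n.
Proof.
elim: n => //= n IHn bg; rewrite bg// IHn// => k kn; exact/bg/ltnW.
Qed.

Lemma elt_ltn (beta : nat -> nat) : {homo elt beta : m n / (m < n)%N}.
Proof.
by apply: homo_ltn => [//|i]; [exact: ltn_trans|rewrite /= ltnS leq_addr].
Qed.

Lemma elt_leq (beta : nat -> nat) : {homo elt beta : m n / (m <= n)%N}.
Proof. by move=> m n; rewrite leq_eqVlt => /predU1P[->//|/elt_ltn/ltnW]. Qed.

Lemma elt_inj (beta : nat -> nat) : injective (elt beta).
Proof.
move=> m n mn; case: (ltngtP m n) => [/(elt_ltn beta)|/(elt_ltn beta)|//];
  by rewrite mn ltnn.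
Qed.

Lemma leq_elt (beta : nat -> nat) (n : nat) : (n <= elt beta n)%N.
Proof. by elim: n => // n IHn; apply: leq_ltn_trans IHn (elt_ltn _ _ _ _). Qed.

Definition elts (beta : nat -> nat) : cantor_space :=
  fun i => `[< exists n, i = elt beta n >].

(** Cutting right after the element of index [n] leaves the gap [beta n] still free to be chosen. *)
Definition segment (beta : nat -> nat) (n : nat) : cantor_space :=
  trunc (elts beta) (elt beta n).+1.

Lemma elts_elt (beta : nat -> nat) (n : nat) : elts beta (elt beta n).
Proof. by apply/asboolP; exists n. Qed.

Lemma elts_infinite (beta : nat -> nat) (n : nat) :
  elts beta <> trunc (elts beta) n.
Proof.
move=> /(congr1 (@^~ (elt beta n))).
by rewrite elts_elt /trunc ltnNge leq_elt.
Qed.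

Lemma elts_between (beta : nat -> nat) (n i : nat) :
  (elt beta n < i < elt beta n.+1)%N -> elts beta i = false.
Proof.
move=> /andP[ni iSn]; apply/negbTE/negP => /asboolP[k ik].
move: ni iSn; rewrite ik; case: (leqP k n) => [kn|nk].
  by rewrite ltnNge elt_leq.
by move=> _; rewrite ltnNge elt_leq.
Qed.

Lemma segmentP (beta : nat -> nat) (n i : nat) :
  segment beta n i <-> exists2 k, (k <= n)%N & i = elt beta k.
Proof.
rewrite /segment /trunc; split=> [/andP[iSn /asboolP[k iE]]|[k kn ->]].
  have kn : (elt beta k <= elt beta n)%N by rewrite -iE.
  exists k => //; rewrite leqNgt; apply/negP => nk.
  by move: kn; rewrite leqNgt elt_ltn.
by rewrite ltnS elt_leq// elts_elt.
Qed.

Lemma eq_segment (beta gamma : nat -> nat) (n : nat) :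
  (forall k, (k < n)%N -> beta k = gamma k) -> segment beta n = segment gamma n.
Proof.
move=> bg; have bg_elt k : (k <= n)%N -> elt beta k = elt gamma k.
  by move=> kn; apply: eq_elt => j jk; apply: bg; apply: leq_trans kn.
apply/funext => i; apply/idP/idP => /segmentP[k kn ->]; apply/segmentP;
  by exists k; rewrite ?bg_elt.
Qed.

Lemma segment_inj (beta : nat -> nat) : injective (segment beta).
Proof.
suff le m n : segment beta m = segment beta n -> (m <= n)%N.
  by move=> m n mn; apply/eqP; rewrite eqn_leq !le.
move=> mn; have : segment beta m (elt beta m) by apply/segmentP; exists m.
by rewrite mn => /segmentP[k kn /elt_inj ->].
Qed.

Lemma segment_lt_nextE (beta : nat -> nat) (n k : nat) :
  (k < elt beta n.+1)%N -> elts beta k = segment beta n k.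
Proof.
move=> kSn; rewrite /segment /trunc ltnS; case: leqP => //= nk.
by apply: (@elts_between _ n); rewrite nk.
Qed.

Lemma segment_trunc_elt (beta gamma : nat -> nat) (n m : nat) :
  segment beta n = trunc (elts gamma) m ->
  forall k, (k <= n)%N -> elt beta k = elt gamma k.
Proof.
move=> seg; elim=> // k IHk kn; have {}IHk := IHk (ltnW kn).
have below j : (j <= elt beta n)%N -> elts beta j = elts gamma j.
  move=> jn; have : (elt beta n < m)%N.
    have : segment beta n (elt beta n) by apply/segmentP; exists n.
    by rewrite seg => /andP[].
  move=> /(leq_ltn_trans jn) jm; have := congr1 (@^~ j) seg.
  by rewrite /segment /trunc ltnS jn jm.
have kSn := elt_leq beta _ _ kn.
(* The smaller of the two next elements would lie in a gap of the other set. *)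
case: (ltngtP (elt beta k.+1) (elt gamma k.+1)) => // lt.
- have := elts_elt beta k.+1; rewrite below// (@elts_between gamma k)//.
  by rewrite lt -IHk elt_ltn.
- have := elts_elt gamma k.+1; rewrite -below ?(@elts_between beta k)//.
    by rewrite lt IHk elt_ltn.
  exact: leq_trans (ltnW lt) kSn.
Qed.

(** As [i < elt beta i.+1], membership of [i] is read off [segment beta i], hence off the first [i]
    gaps. *)
Lemma elts_continuous : continuous (elts : baire_space -> cantor_space).
Proof.
apply: ptws_continuous => i; apply: near_continuous => beta.
apply: filterS (@nbhs_agree nat beta i) => gamma gb.
have lt_next delta : (i < elt delta i.+1)%N by exact: leq_elt.
by rewrite !(segment_lt_nextE _ _ _ (lt_next _)) (eq_segment _ _ _ gb).
Qed.

(* A fusion argument: [beta] is built so that its [n]-th gap is long enough to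
   keep [elts beta] inside the neighbourhood [V n (segment beta n)]. *)
Lemma generic_sequence (V : nat -> cantor_space -> set cantor_space) :
  (forall beta n, nbhs (segment beta n) (V n (segment beta n))) ->
  exists beta, forall n, V n (segment beta n) (elts beta).
Proof.
move=> nV.
have /choice[g gP] : forall p : nat * (nat -> nat), exists k,
    forall y : cantor_space, (forall j, (j < k)%N -> y j = segment p.2 p.1 j) ->
      V p.1 (segment p.2 p.1) y.
  by move=> [n beta]; exact: agree_nbhs (nV beta n).
(* [s n] lists the first [n] gaps; padding it with 0 is harmless, since [segment _ n] reads only
   these. *)
pose s := fix s n := if n is m.+1 then rcons (s m) (g (m, nth 0%N (s m)))
                     else [::].
have size_s n : size (s n) = n by elim: n => //= n IHn; rewrite size_rcons IHn.
have s_stable n m k : (k < n)%N -> (n <= m)%N ->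
    nth 0%N (s m) k = nth 0%N (s n) k.
  move=> kn; elim: m => [|m IHm]; first by rewrite leqn0 => /eqP ->.
  rewrite leq_eqVlt => /predU1P[->//|]; rewrite ltnS => nm.
  by rewrite /= nth_rcons size_s (leq_trans kn nm) IHm.
pose beta k := nth 0%N (s k.+1) k.
have s_beta n k : (k < n)%N -> nth 0%N (s n) k = beta k.
  by move=> kn; exact: s_stable.
exists beta => n; rewrite -(eq_segment _ _ _ (s_beta n)).
apply: (gP (n, nth 0%N (s n))) => j /= jg; rewrite (eq_segment _ _ _ (s_beta n)).
apply: segment_lt_nextE; rewrite /= ltnS (leq_trans (ltnW jg))//.
by rewrite /beta /= nth_rcons size_s ltnn eqxx leq_addl.
Qed.

(** * Recovery sequences in an accessible space *)

Section recovery.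
Variables (X : topologicalType) (W : nat -> set X) (D : nat -> X).
Hypothesis X_T1 : accessible_space X.
Hypothesis W_basis : basis (range W).
Hypothesis D_dense : dense (range D).

Let finite_le n : finite_set [set i | (i <= n)%N] := finite_II n.+1.

Lemma recovery_seq_in_range (x : X) (n : nat) :
  exists p, recovery_seq W D x n = D p.
Proof.
elim: n => [|n [p IHp]]; first by exists 0%N.
by rewrite recovery_seqS; case: ifP => _; [exists p|eexists].
Qed.

Lemma recovery_seq_stable (x : X) (m n : nat) : (m <= n)%N ->
  recovery_seq W D x m = x -> recovery_seq W D x n = x.
Proof.
move=> + mx; elim: n => [|n IHn]; first by rewrite leqn0 => /eqP <-.
rewrite leq_eqVlt => /predU1P[<-//|]; rewrite ltnS => /IHn nx.
by rewrite recovery_seqS nx eqxx.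
Qed.

Lemma recovery_seq_next (x : X) (n : nat) : recovery_seq W D x n <> x ->
  let S := [set recovery_seq W D x i | i in [set i | (i <= n)%N]] in
  exists p, [/\ recovery_seq W D x n.+1 = D p, candidate W D x S p &
                forall q, candidate W D x S q -> (p <= q)%N].
Proof.
move=> nx S; exists (least_candidate W D x S).
have cS : closed S.
  by apply: (accessible_finite_set_closed.1 X_T1); apply: finite_image.
have Sx : ~ S x by move=> [i /= ni ix]; exact/nx/(recovery_seq_stable _ _ _ ni).
have [? ?] := candidate_exists W_basis D_dense cS Sx.
by split=> //; rewrite recovery_seqS eq_sym; case: eqP.
Qed.

(** Each newly chosen term lies in some [W k] that avoids all earlier terms. *)
Lemma recovery_seq_inj (x : X) : (forall n, recovery_seq W D x n <> x) ->
  injective (recovery_seq W D x).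
Proof.
move=> xs; suff lt_neq m n : (m < n)%N ->
    recovery_seq W D x m <> recovery_seq W D x n.
  move=> m n mn; case: (ltngtP m n) => // /lt_neq; first by rewrite mn.
  by move=> /(_ (esym mn)).
case: n => // n; rewrite ltnS => mn.
have [p [-> [k [xpW WS]] _]] := recovery_seq_next _ _ (xs n).
by move=> mp; apply: (WS (D p)); [apply: xpW; right|exists m].
Qed.

(* If [W m] contains [D p] and avoids the other [D q] with [q <= p], then for
   [y] in [W m] the index [p] stays a candidate until it is chosen, so only
   the finitely many indices [q <= p] can be chosen before. *)
Lemma recovery_seq_reaches (p : nat) :
  nbhs (D p) [set y | exists n, recovery_seq W D y n = D p].
Proof.
pose F := [set D q | q in [set q | (q <= p)%N]] `\ D p.
have cF : closed F.
  apply: (accessible_finite_set_closed.1 X_T1).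
  by apply: finite_setD; apply: finite_image.
have FDp : nbhs (D p) (~` F).
  by apply: open_nbhs_nbhs; split; [exact: closed_openC|move=> [_]; exact].
have [_ [[m _ <-] Wmp] WF] := W_basis.2 _ _ FDp.
apply: filterS (open_nbhs_nbhs _); last first.
  by split; [apply: W_basis.1; exists m|exact: Wmp].
move=> y Wmy /=; apply: contrapT => /forallNP nreach.
have le_p : forall n, exists2 q, (q < p.+1)%N & recovery_seq W D y n = D q.
  suff below n : forall i, (i <= n)%N ->
      exists2 q, (q < p.+1)%N & recovery_seq W D y i = D q.
    by move=> n; exact: (below n).
  elim: n => [|n IHn] i; first by rewrite leqn0 => /eqP ->; exists 0%N.
  rewrite leq_eqVlt => /predU1P[->|]; last by rewrite ltnS; exact: IHn.
  have [yn|/eqP yn] := eqVneq (recovery_seq W D y n) y.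
    by rewrite recovery_seqS yn eqxx -yn; exact: IHn.
  have [q [-> _ q_min]] := recovery_seq_next _ _ yn.
  exists q => //; rewrite ltnS; apply: q_min; exists m; split.
    by move=> z [->|->].
  move=> z /WF Fz [j /= jn jz]; apply: Fz; split; last first.
    by rewrite -jz; exact: nreach.
  by have [r rp jr] := IHn _ jn; exists r; rewrite //= -jr.
(* The sequence is injective because it never equals [y]: otherwise [y] would be some [D q] with
   [q <= p], different from [D p], and such points are outside [W m]. *)
apply: (no_injection_below _ _ _ _ _ le_p); apply: recovery_seq_inj => n ny.
have [q qp nq] := le_p n; apply: (WF y) => //; split; last first.
  by move=> /= yp; apply: (nreach n); rewrite ny.
by exists q; rewrite //= -nq.
Qed.

End recovery.

(** * Failure of uniform recoverability *)

Lemma recoverable_near (X : topologicalType) (W : nat -> set X) (D : nat -> X)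
    (f : X -> bool) : recoverable W D f ->
  forall x, \forall n \near \oo, f (recovery_seq W D x n) = f x.
Proof. by move=> rec x; exact: rec x _ (discrete_set1 (f x)). Qed.

Lemma cantor_accessible : accessible_space cantor_space.
Proof. exact/hausdorff_accessible/cantor_space_hausdorff. Qed.

Lemma segment_in_range (W : nat -> set cantor_space) (D : nat -> cantor_space) :
  basis (range W) -> dense (range D) ->
  (forall beta,
     recoverable W D (truncations (elts beta) : cantor_space -> bool)) ->
  forall beta n, exists p, segment beta n = D p.
Proof.
move=> Wb Dd rec beta n; set x := segment beta n.
apply: contrapT => /forallNP xD.
pose s := recovery_seq W D x; pose e := elt beta n.
have s_inj : injective s.
  apply: (recovery_seq_inj _ _ _ cantor_accessible Wb Dd) => k; 
  have [p ->] := recovery_seq_in_range _ W D x k.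
  by move=> /esym; exact: xD.
(* All [elts (ext j)] extend [x]; the element following [e] is [e + 1] for [j = 0] and [e + 2] for
   [j = 1]. These two extensions suffice. *)
pose ext j i := if (i < n)%N then beta i else j.
have ext_beta j k : (k < n)%N -> ext j k = beta k by rewrite /ext => ->.
have elt_ext j : elt (ext j) n = e by exact/eq_elt/ext_beta.
have elt_extS j : elt (ext j) n.+1 = (e + j).+1 by rewrite /= elt_ext /ext ltnn.
have s_ext j : \forall k \near \oo, exists m, s k = trunc (elts (ext j)) m.
  have xj : truncations (elts (ext j)) x = true.
    apply/asboolP; exists (elt (ext j) n).+1.
    by rewrite -[LHS](eq_segment _ _ _ (ext_beta j)).
  have := recoverable_near _ _ _ _ (rec (ext j)) x.
  by apply: filterS => k; rewrite xj => /asboolP.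
have [N _ sN] := filterI (s_ext 0%N) (s_ext 1%N).
apply: (no_injection_below _ (fun k => s (N + k)%N) (trunc x) e.+2).
  by move=> k l /s_inj/addnI.
move=> k; have [[m0 s0] [m1 s1]] := sN (N + k)%N (leq_addr _ _).
have [m0e|m0e] := ltnP m0 e.+2.
  exists m0 => //; rewrite /x -(eq_segment _ _ _ (ext_beta 0%N)) /segment.
  by rewrite trunc_trunc elt_ext s0; congr trunc; rewrite (minn_idPl _).
(* A truncation of [elts (ext 0)] of length at least [e + 2] contains [e + 1], which [elts (ext 1)]
   omits. *)
have /= := congr1 (@^~ e.+1) (etrans (esym s0) s1).
have := elts_elt (ext 0%N) n.+1; rewrite elt_extS addn0 /trunc m0e => ->.
rewrite (@elts_between (ext 1%N) n) ?andbF// elt_ext elt_extS addn1.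
by rewrite !ltnSn.
Qed.

(** Stated for any [A] containing the functions of infinite sets with element 0, so that it serves
    both (a) and (b). *)
Lemma not_uniformly_recoverable (W : nat -> set cantor_space)
    (A : set (baire1 cantor_space bool)) : basis (range W) ->
  (forall beta, exists2 f, A f & fun_of_baire1 f = truncations (elts beta)) ->
  ~ uniformly_recoverable W A.
Proof.
move=> Wb Aelts [D [Dd recA]].
have rec beta : recoverable W D (truncations (elts beta) : cantor_space -> bool).
  by have [f Af <-] := Aelts beta; exact: recA.
have [beta reach] : exists beta, forall n, exists k,
    recovery_seq W D (elts beta) k = segment beta n.
  apply: (generic_sequence (fun _ x =>
    [set y | exists k, recovery_seq W D y k = x])).
  move=> beta n; have [p ->] := segment_in_range W D Wb Dd rec beta n.
  exact: (recovery_seq_reaches _ _ _ cantor_accessible Wb Dd).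
have a0 : truncations (elts beta) (elts beta) = false.
  by apply/asboolP => -[n]; exact: elts_infinite.
have [N _ recN] := recoverable_near _ _ _ _ (rec beta) (elts beta).
(* Every segment has value 1 while the limit value is 0, so all segments are reached before stage
   [N], although they are pairwise distinct. *)
apply: (no_injection_below _ _ (recovery_seq W D (elts beta)) N (@segment_inj beta)).
move=> n; have [k kn] := reach n; exists k => //; rewrite ltnNge; apply/negP.
move=> /recN /=; rewrite a0 kn => /negbT/negP; apply; apply/asboolP.
by exists (elt beta n).+1.
Qed.

(** * Baire class one criteria and the evaluation map of (a) *)

Lemma closed_true (X : topologicalType) (b : X -> bool) :
  continuous b -> closed [set x | b x].
Proof.
move=> cb; apply: (@preimage_closed _ _ b [set true]) => [x _|]; first exact: cb.
exact: discrete_closed.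
Qed.

Lemma baire_class_one_bool (X : topologicalType) (f : X -> bool) :
  Fsigma [set x | f x = true] -> Fsigma [set x | f x = false] ->
  baire_class_one f.
Proof.
move=> Ft Ff U _.
have [Ut|Ut] := pselect (U true); have [Uf|Uf] := pselect (U false).
- rewrite (_ : f @^-1` U = setT); first exact/closed_Fsigma/closedT.
  by apply/seteqP; split=> // x _ /=; case: (f x).
- rewrite (_ : f @^-1` U = [set x | f x = true]) //.
  by apply/seteqP; split=> x /=; case: (f x).
- rewrite (_ : f @^-1` U = [set x | f x = false]) //.
  by apply/seteqP; split=> x /=; case: (f x).
- rewrite (_ : f @^-1` U = set0); first exact/closed_Fsigma/closed0.
  by apply/seteqP; split=> // x /=; case: (f x).
Qed.

(* The relation [forall i, agree_upto x a i] is closed, so the condition defines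
   the difference of two closed sets, each given by countably many clopen
   ones. *)
Lemma baire_class_one_agree (X : topologicalType) (f : X -> bool)
    (u v w : X -> cantor_space) : continuous u -> continuous v -> continuous w ->
  (forall x, f x = true <-> (forall i, agree_upto (u x) (v x) i) /\ u x <> w x) ->
  baire_class_one f.
Proof.
move=> cu cv cw fP.
have agree_near (h : X -> cantor_space) x n : continuous h ->
    \forall y \near x, forall k, (k < n)%N -> h y k = h x k.
  by move=> ch; exact: ch (@nbhs_agree bool (h x) n).
have c_agree i : continuous (fun x => agree_upto (u x) (v x) i).
  apply: near_continuous => x.
  apply: filterS2 (agree_near u x i.+1 cu) (agree_near v x i.+1 cv) => y uy vy.
  rewrite /agree_upto uy//; congr implb; apply: eq_forallb => j.
  by rewrite uy ?vy.
have c_neq i : continuous (fun x => u x i != w x i).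
  apply: near_continuous => x.
  apply: filterS2 (agree_near u x i.+1 cu) (agree_near w x i.+1 cw) => y uy wy.
  by rewrite /= uy ?wy.
have neqP x : u x <> w x <-> exists i, u x i != w x i.
  split=> [uw|[i /eqP uwi uw]]; last by rewrite uw in uwi.
  apply: contrapT => /forallNP uwE; apply: uw; apply/funext => i.
  exact/eqP/negPn/negP/uwE.
have cC : closed [set x | forall i, agree_upto (u x) (v x) i].
  rewrite (_ : mkset _ = \bigcap_i [set x | agree_upto (u x) (v x) i]).
    by apply: closed_bigI => i _; exact: closed_true.
  by apply/seteqP; split=> [x xC i _|x xC i]; exact: xC.
apply: baire_class_one_bool.
  exists (fun n => [set x | forall i, agree_upto (u x) (v x) i] `&`
                   [set x | u x n != w x n]).
    by move=> n; apply: closedI => //; exact: closed_true.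
  apply/seteqP; split=> [x /fP[xC /neqP[i xi]]|x [i _ [xC xi]]].
    by exists i.
  by apply/fP; split=> //; apply/neqP; exists i.
exists (fun n => if n is k.+1 then [set x | ~~ agree_upto (u x) (v x) k]
                 else [set x | u x = w x]).
  case=> [|k].
    rewrite (_ : mkset _ = \bigcap_i [set x | ~~ (u x i != w x i)]).
      apply: closed_bigI => i _; apply: closed_true; apply: near_continuous => x.
      by apply: filterS (continuous_near _ _ _ (c_neq i) x) => y ->.
    apply/seteqP; split=> [x uw i _|x xuw] /=; first by rewrite uw eqxx.
    by apply/funext => i; exact/eqP/negPn/(xuw i).
  apply: closed_true; apply: near_continuous => x.
  by apply: filterS (continuous_near _ _ _ (c_agree k) x) => y ->.
apply/seteqP; split=> [x /= fx|x [[|k] _ /=]].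
- have [xC|/existsNP[k /negP xk]] := pselect (forall i, agree_upto (u x) (v x) i).
    exists 0%N => //=; apply: contrapT => uw.
    have /fP : (forall i, agree_upto (u x) (v x) i) /\ u x <> w x by [].
    by rewrite fx.
  by exists k.+1.
- by move=> uw; apply: contraTF isT => /fP[].
- by move=> /negP xk; apply/negbTE/negP => /fP[/(_ k)].
Qed.

Lemma truncations_baire1 (a : cantor_space) :
  baire1 cantor_space bool (truncations a).
Proof.
have [[n an]|/forallNP a_inf] := pselect (exists n, a = trunc a n).
  apply: (@baire_class_one_agree _ _ id (cst a) (cst (fun=> true))) => [||| x].
  - by move=> x; exact: cvg_id.
  - exact: cst_continuous.
  - exact: cst_continuous.
  exact: truncationsP_finite an.
apply: (@baire_class_one_agree _ _ id (cst a) (cst a)) => [||| x].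
- by move=> x; exact: cvg_id.
- exact: cst_continuous.
- exact: cst_continuous.
exact: truncationsP.
Qed.

Definition truncation_fun (a : cantor_space) : baire1 cantor_space bool :=
  exist _ (truncations a) (mem_set (truncations_baire1 a)).

Lemma truncation_fun_continuous : continuous truncation_fun.
Proof.
apply: continuous_comp_initial => a; exact: truncations_continuous.
Qed.

(** A Baire category argument: [F n] consists of infinite sets, so its open complement is a
    neighbourhood of every segment, and [generic_sequence] gives an infinite set outside all
    [F n]. *)
Lemma infinite_not_Fsigma :
  ~ Fsigma [set a : cantor_space | truncations a a = false].
Proof.
move=> [F cF FE].
have [beta avoids] : exists beta, forall n, ~ F n (elts beta).
  apply: (generic_sequence (fun n _ => ~` F n)) => beta n.
  apply: open_nbhs_nbhs; split; first exact: closed_openC.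
  move=> Fn; have : (\bigcup_i F i) (segment beta n) by exists n.
  rewrite -FE /= => /asboolP; apply; exists (elt beta n).+1.
  by rewrite trunc_trunc minnn.
have : [set a : cantor_space | truncations a a = false] (elts beta).
  by apply/asboolP => -[n]; exact: elts_infinite.
by rewrite FE => -[n _]; exact: avoids.
Qed.

Lemma Fsigma_preimage (X Y : topologicalType) (g : X -> Y) (S : set Y) :
  continuous g -> Fsigma S -> Fsigma (g @^-1` S).
Proof.
move=> cg [F cF ->]; exists (fun n => g @^-1` F n); last exact: preimage_bigcup.
by move=> n; apply: preimage_closed => // x _; exact: cg.
Qed.

(** A single value of f_a determines finitely many gaps; this yields both injectivity and continuity
    of the inverse. *)
Lemma truncations_eltsP (beta gamma : nat -> nat) (n : nat) :
  truncations (elts gamma) (segment beta n) ->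
  forall k, (k < n)%N -> gamma k = beta k.
Proof.
move=> /asboolP[m /segment_trunc_elt bg] k kn.
have := bg _ kn; rewrite /= (bg _ (ltnW kn)) => -[/addnI] //.
Qed.

Lemma truncation_fun_elts_inj : injective (truncation_fun \o elts).
Proof.
move=> beta gamma /(congr1 set_val)/= bg; apply/esym/funext => k.
apply: (truncations_eltsP _ _ k.+1) => //.
rewrite -[truncations _]bg; apply/asboolP.
by exists (elt beta k.+1).+1.
Qed.

Lemma fun_of_baire1_continuous (X Y : topologicalType) (A : set (baire1 X Y))
  (x : X) : continuous (fun f : A => fun_of_baire1 (set_val f) x).
Proof.
move=> f.
apply: (@continuous_comp _ _ _ (set_val : A -> baire1 X Y)
                         (fun g => fun_of_baire1 g x)).
  exact: initial_continuous.
apply: (@continuous_comp _ _ _ (set_val : baire1 X Y -> {ptws X -> Y})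
                         (fun g => g x)).
  exact: initial_continuous.
exact: (@proj_continuous {classic X} (fun=> Y) x).
Qed.

(** The preimage of [false], pulled back along the continuous diagonal [g], is the set of infinite
    sets. *)
Lemma evaluation_truncation_fun_not_baire1 :
  ~ baire_class_one (@evaluation cantor_space bool (range truncation_fun)).
Proof.
move=> /(_ [set false] (discrete_open _)) evF; apply: infinite_not_Fsigma.
have mem_I a : truncation_fun a \in range truncation_fun.
  by apply/mem_set; exists a.
pose gI a : range truncation_fun := exist _ (truncation_fun a) (mem_I a).
pose g a := (a : cantor_space, gI a).
apply: (Fsigma_preimage _ _ g _ _ evF) => a.
have gI_a : gI @ a --> gI a.
  by apply: continuous_comp_initial; exact: truncation_fun_continuous.
exact: cvg_pair (@cvg_id _ (nbhs a)) gI_a.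
Qed.

(** * The copy of Baire space and the evaluation map of (b) *)

Section irrationals.

Let A : set (baire1 cantor_space bool) := range (truncation_fun \o elts).

Let of_seq (beta : baire_space) : A :=
  exist _ (truncation_fun (elts beta))
    (mem_set (imageT (truncation_fun \o elts) beta)).

Let to_seq_ex (f : A) : exists beta, truncation_fun (elts beta) = set_val f.
Proof. by have [beta _ fE] := set_valP f; exists beta. Qed.

Let to_seq (f : A) : baire_space := projT1 (cid (to_seq_ex f)).

Let to_seqP (f : A) : truncation_fun (elts (to_seq f)) = set_val f.
Proof. exact: projT2 (cid (to_seq_ex f)). Qed.

Let of_seqK : cancel of_seq to_seq.
Proof. by move=> beta; apply: truncation_fun_elts_inj; rewrite /= to_seqP. Qed.

Let to_seqK : cancel to_seq of_seq.
Proof. by move=> f; apply: val_inj; exact: to_seqP. Qed.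

Let of_seq_continuous : continuous of_seq.
Proof.
apply: continuous_comp_initial => beta.
apply: (@continuous_comp baire_space _ _ elts truncation_fun).
  exact: elts_continuous.
exact: truncation_fun_continuous.
Qed.

(** Having value 1 at the one point [x] is an open condition on [h], and it fixes the gaps of [h] up
    to index [i]. *)
Let to_seq_continuous : continuous to_seq.
Proof.
apply: ptws_continuous => i; apply: near_continuous => f.
pose x := segment (to_seq f) i.+1.
have evP (h : A) : fun_of_baire1 (set_val h) x = truncations (elts (to_seq h)) x.
  by rewrite -to_seqP.
have := continuous_near _ _ _ (fun_of_baire1_continuous _ _ A x) f.
apply: filterS => h; rewrite !evP => hx.
apply: (truncations_eltsP _ _ i.+1) => //.
by rewrite -/x hx; apply/asboolP; exists (elt (to_seq f) i.+1).+1.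
Qed.

Lemma homeomorphic_truncation_fun_elts : homeomorphic A baire_space.
Proof. by exists to_seq, of_seq. Qed.

(** The set [a] depends continuously on f_a through [to_seq] and is always infinite, so
    [truncationsP] describes the evaluation jointly in both variables. *)
Lemma evaluation_truncation_fun_elts_baire1 :
  baire_class_one (@evaluation cantor_space bool A).
Proof.
have c2 : continuous (fun p : cantor_space * A => elts (to_seq p.2)).
  move=> p; apply: (@continuous_comp _ baire_space _ (fun p => to_seq p.2) elts).
    apply: (@continuous_comp _ _ _ snd to_seq); first exact: cvg_snd.
    exact: to_seq_continuous.
  exact: elts_continuous.
apply: (baire_class_one_agree _ _ _ _ _ _ c2 c2) => [p|p]; first exact: cvg_fst.
rewrite /evaluation -to_seqP; apply: truncationsP => n; exact: elts_infinite.
Qed.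

End irrationals.

Theorem corollary16 (W : nat -> set cantor_space) (W_good : good_basis W) :
  (exists I : cantor_space -> baire1 cantor_space bool,
     [/\ continuous I,
         injective I,
         ~ uniformly_recoverable W (range I) &
         ~ baire_class_one (@evaluation cantor_space bool (range I))]) /\
  (exists A : set (baire1 cantor_space bool),
     [/\ homeomorphic A baire_space,
         ~ uniformly_recoverable W A &
         baire_class_one (@evaluation cantor_space bool A)]).
Proof.
move: W_good => [Wb _]; split.
  exists truncation_fun; split; first exact: truncation_fun_continuous.
  - by move=> a b /(congr1 set_val); exact: truncations_inj.
  - apply: not_uniformly_recoverable => // beta.
    by exists (truncation_fun (elts beta)); [exists (elts beta)|].
  - exact: evaluation_truncation_fun_not_baire1.
exists (range (truncation_fun \o elts)); split.
- exact: homeomorphic_truncation_fun_elts.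
- apply: not_uniformly_recoverable => // beta.
  by exists (truncation_fun (elts beta)); [exists beta|].
- exact: evaluation_truncation_fun_elts_baire1.
Qed.
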